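(* (Double Lagrange's mean value theorem) Let $a,b\in\mathbb{R}^2$ satisfy $a<b$. Suppose that $f:[a,b]\to\mathbb{R}$ is a double continuous function on $[a,b]$ which is double differentiable on $(a,b)$. Then there exists $c\in(a,b)$ with $f'(c)=m_a^b(f)$.
   Context: Points of $\mathbb{R}^2$ are written $a=(a_1,a_2)$. For $a,b\in\mathbb{R}^2$: $a<b$ means $a_1<b_1$ and $a_2<b_2$; $a\le b$ means $a_1\le b_1$ and $a_2\le b_2$; $a\nsim b$ means $a_1\ne b_1$ and $a_2\ne b_2$. $[a,b]=\{x\in\mathbb{R}^2: a\le x\le b\}$ and $(a,b)=\{x\in\mathbb{R}^2: a<x<b\}$. A double function is a real-valued function $f$ with domain $D(f)\subseteq\mathbb{R}^2$. The double difference is $\Delta_a^b(f)=f(b_1,b_2)-f(b_1,a_2)-f(a_1,b_2)+f(a_1,a_2)$ (whenever the four values are defined). Double continuity at a point: $f$ is double continuous at $a$ if there is a product $I=I_1\times I_2$ of open intervals with $a\in I\subseteq D(f)$ such that for all $x_1\in I_1$, $\lim_{x_2\to a_2}\Delta_a^{x}(f)=0$, and for all $x_2\in I_2$, $\lim_{x_1\to a_1}\Delta_a^{x}(f)=0$, where $x=(x_1,x_2)$. Signed double continuity: for $\delta=(\delta_1,\delta_2)$ with $\delta_1,\delta_2>0$, let $D_{++}(a,\delta)=[a_1,a_1+\delta_1)\times[a_2,a_2+\delta_2)$, $D_{+-}(a,\delta)=[a_1,a_1+\delta_1)\times(a_2-\delta_2,a_2]$, $D_{-+}(a,\delta)=(a_1-\delta_1,a_1]\times[a_2,a_2+\delta_2)$,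 $D_{--}(a,\delta)=(a_1-\delta_1,a_1]\times(a_2-\delta_2,a_2]$. For signs $\sigma,\tau\in\{+,-\}$, $f$ is $\sigma\tau$-double continuous at $a$ if there is such a $\delta$ with $I:=D_{\sigma\tau}(a,\delta)\subseteq D(f)$ such that for all $x_1\in I_1$, $\lim_{x_2\to a_2^{\tau}}\Delta_a^x(f)=0$ and for all $x_2\in I_2$, $\lim_{x_1\to a_1^{\sigma}}\Delta_a^x(f)=0$ (one-sided limits). $f$ is double continuous on $[a,b]$ if it is double continuous at each interior point of $[a,b]$ and, at each boundary point $p$ of $[a,b]$, it is $\sigma\tau$-double continuous for every sign pair $\sigma\tau$ such that $D_{\sigma\tau}(p,\delta)\subseteq[a,b]$ for some $\delta$. Double mean slope and double differentiability: for $a\nsim x$ put $m_a^x(f)=\Delta_a^x(f)/((x_1-a_1)(x_2-a_2))$. $f$ is double differentiable at $a$ if $D(f)$ contains a product of open intervals containing $a$ and there is a real number $f'(a)$ (the double derivative) such that for every $\epsilon>0$ there is $\delta=(\delta_1,\delta_2)$ with $\delta_1,\delta_2>0$ such that for all $x$ with $0<|x_1-a_1|<\delta_1$ and $0<|x_2-a_2|<\delta_2$, $m_a^x(f)$ is defined and $|m_a^x(f)-f'(a)|<\epsilon$. $f$ is double differentiable on $(a,b)$ if it is so at each point of $(a,b)$. *)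

(* Defs.v *)
From HB Require Import structures.
From mathcomp Require Import all_boot all_order all_algebra.
From mathcomp Require Import all_classical all_reals all_analysis.

Set Implicit Arguments.
Unset Strict Implicit.
Unset Printing Implicit Defensive.

Import Order.TTheory GRing.Theory Num.Theory.
Import numFieldNormedType.Exports.

Local Open Scope classical_set_scope.
Local Open Scope ring_scope.

Section DoubleFunctions.
Context {R : realType}.
Implicit Types a b p : R * R.

Definition pt_lt a b : Prop := a.1 < b.1 /\ a.2 < b.2.
Definition pt_le a b : Prop := a.1 <= b.1 /\ a.2 <= b.2.
Definition pt_nsim a b : Prop := a.1 <> b.1 /\ a.2 <> b.2.

Definition closed_box a b : set (R * R) := [set x | pt_le a x /\ pt_le x b].
Definition open_box a b : set (R * R) := [set x | pt_lt a x /\ pt_lt x b].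

(* A partial real function on the plane: [dval] is total, but its values
   outside [dom] are meaningless, so every definition below evaluates it only
   at points that are required to lie in [dom]. *)
Record double_function := DoubleFunction {
  dom : set (R * R);
  dval :> R * R -> R }.

Implicit Type f : double_function.

Definition double_difference f a b : R :=
  f (b.1, b.2) - f (b.1, a.2) - f (a.1, b.2) + f (a.1, a.2).

Definition double_difference_defined f a b : Prop :=
  [/\ dom f (b.1, b.2), dom f (b.1, a.2), dom f (a.1, b.2) & dom f (a.1, a.2)].

Definition double_mean_slope f a (x : R * R) : R :=
  double_difference f a x / ((x.1 - a.1) * (x.2 - a.2)).

Definition double_mean_slope_defined f a (x : R * R) : Prop :=
  pt_nsim a x /\ double_difference_defined f a x.

Definition open_interval (I : set R) : Prop := open I /\ is_interval I.

Definition double_continuous_at f a : Prop :=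
  exists I1 I2 : set R,
    [/\ open_interval I1 /\ open_interval I2,
        (I1 `*` I2) a,
        I1 `*` I2 `<=` dom f,
        forall x1, I1 x1 ->
          double_difference f a (x1, x2) @[x2 --> (a.2)^'] --> (0 : R) &
        forall x2, I2 x2 ->
          double_difference f a (x1, x2) @[x1 --> (a.1)^'] --> (0 : R)].

Inductive sign := Plus | Minus.

Definition half_interval (s : sign) (t e : R) : set R :=
  match s with
  | Plus => [set u | t <= u < t + e]
  | Minus => [set u | t - e < u <= t]
  end.

Definition at_side (s : sign) (t : R) : set_system R :=
  match s with
  | Plus => t^'+
  | Minus => t^'-
  end.

(* The set D_{s t}(a, d). *)
Definition quadrant (s t : sign) a (d : R * R) : set (R * R) :=
  half_interval s a.1 d.1 `*` half_interval t a.2 d.2.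

Definition signed_double_continuous_at (s t : sign) f a : Prop :=
  exists d : R * R,
    [/\ 0 < d.1 /\ 0 < d.2,
        quadrant s t a d `<=` dom f,
        forall x1, half_interval s a.1 d.1 x1 ->
          double_difference f a (x1, x2) @[x2 --> at_side t a.2] --> (0 : R) &
        forall x2, half_interval t a.2 d.2 x2 ->
          double_difference f a (x1, x2) @[x1 --> at_side s a.1] --> (0 : R)].

(* Since [closed_box a b] is closed, its boundary points are its points that
   are not interior. *)
Definition double_continuous_on_box f a b : Prop :=
  (forall p, (closed_box a b)° p -> double_continuous_at f p) /\
  (forall p, (closed_box a b `\` (closed_box a b)°) p ->
     forall s t : sign,
       (exists d : R * R,
          (0 < d.1 /\ 0 < d.2) /\ quadrant s t p d `<=` closed_box a b) ->
       signed_double_continuous_at s t f p).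

(* [is_double_derivative f a l]: f is double differentiable at a, with
   f'(a) = l; such an l is unique. *)
Definition is_double_derivative f a (l : R) : Prop :=
  (exists I1 I2 : set R,
     [/\ open_interval I1, open_interval I2, (I1 `*` I2) a &
         I1 `*` I2 `<=` dom f]) /\
  (forall eps : R, 0 < eps ->
     exists d : R * R, (0 < d.1 /\ 0 < d.2) /\
       forall x : R * R, 0 < `|x.1 - a.1| < d.1 -> 0 < `|x.2 - a.2| < d.2 ->
         double_mean_slope_defined f a x /\
         `|double_mean_slope f a x - l| < eps).

Definition double_differentiable_at f a : Prop :=
  exists l : R, is_double_derivative f a l.

End DoubleFunctions.

Arguments double_function R : clear implicits.

(* Main.v *)
(** Double continuity only concerns increments, but chaining it along a segment
  shows that [F x := Delta_a^x f] is separately continuous on the box.  Cut a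
  rectangle into nine equal ones: either some translate of such a ninth, lying
  strictly inside, has the same mean slope, or by separate continuity and the
  intermediate value theorem the difference of the mean slopes keeps a constant
  strict sign on the interior positions and that weak sign on the closed ones,
  contradicting that the nine differences add up to 0.  Iterating gives nested
  rectangles of mean slope [m_a^b f] shrinking to a point strictly inside all of
  them; splitting each rectangle at that point identifies the double derivative
  there with [m_a^b f]. *)
Require Import Defs.
From HB Require Import structures.
From mathcomp Require Import all_boot all_order all_algebra.
From mathcomp Require Import all_classical all_reals all_analysis.
From mathcomp Require Import ring lra.

Set Implicit Arguments.
Unset Strict Implicit.
Unset Printing Implicit Defensive.

Import Order.TTheory GRing.Theory Num.Theory.
Import numFieldNormedType.Exports.

Local Open Scope classical_set_scope.
Local Open Scope ring_scope.

(** * Rectangles of equal mean slope for a separately continuous function *)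

Section MeanSlopes.
Context {R : realType}.
Implicit Types (g : R -> R -> R) (phi : R -> R) (u v w x y h k : R).

Definition rect_diff g u v x y : R := g x y - g x v - g u y + g u v.

Definition separately_continuous g : Prop :=
  (forall y, continuous (g^~ y)) /\ (forall x, continuous (g x)).

Lemma IVT_unordered phi x y w : continuous phi -> phi x <= w <= phi y ->
  exists2 c, x <= c <= y \/ y <= c <= x & phi c = w.
Proof.
move=> cphi /andP[xw wy].
have cw s t : {within `[s, t], continuous phi} by exact: continuous_subspaceT.
have [xy|yx] := leP x y.
  have [|c] := IVT (v := w) xy (cw x y); first by rewrite ge_min le_max xw wy orbT.
  by rewrite in_itv /= => ? ?; exists c => //; left.
have [|c] := IVT (v := w) (ltW yx) (cw y x).
  by rewrite ge_min le_max xw wy orbT.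
by rewrite in_itv /= => ? ?; exists c => //; right.
Qed.

(** If [phi x] were negative, [phi] would take the value [phi x / 2] between [x] and the midpoint at
    a point other than [x], hence inside the open interval, where it is nonnegative. *)
Lemma continuous_ge0_closure phi u v : u < v -> continuous phi ->
  (forall x, u < x < v -> 0 <= phi x) -> forall x, u <= x <= v -> 0 <= phi x.
Proof.
move=> uv cphi pos x xuv; rewrite leNgt; apply/negP => phix.
have pm : 0 <= phi ((u + v) / 2) by apply: pos; lra.
have [|c cx phic] := @IVT_unordered phi x ((u + v) / 2) (phi x / 2) cphi; first lra.
have /eqP cneq : c != x by apply/eqP => e; move: phic; rewrite e; lra.
have := pos c; rewrite phic; have [||//] := ltgtP c x; first by lra.
  by lra.
Qed.

Lemma continuous_nz_gt0 phi u v : continuous phi ->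
  (forall x, u < x < v -> phi x != 0) ->
  forall x y, u < x < v -> u < y < v -> 0 < phi x -> 0 < phi y.
Proof.
move=> cphi nz x y xuv yuv phix; rewrite ltNge; apply/negP => phiy.
have [|c cyx phic] := @IVT_unordered phi y x 0 cphi; first lra.
have : phi c != 0 by apply: nz; case: cyx; lra.
by rewrite phic eqxx.
Qed.

Lemma separately_continuousN g :
  separately_continuous g -> separately_continuous (fun x y => - g x y).
Proof. by move=> [c1 c2]; split=> z t; apply: cvgN; [exact: c1|exact: c2]. Qed.

(** The sign travels from [(x0, y0)] along axis-parallel segments only, first in [x] and then in
    [y], so separate continuity suffices; the edges are then reached one coordinate at a time. *)
Lemma separately_continuous_nz_ge0 g u v u' v' x0 y0 :
  separately_continuous g -> u < u' -> v < v' ->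
  u < x0 < u' -> v < y0 < v' -> 0 < g x0 y0 ->
  (forall x y, u < x < u' -> v < y < v' -> g x y != 0) ->
  forall x y, u <= x <= u' -> v <= y <= v' -> 0 <= g x y.
Proof.
move=> [c1 c2] uu vv x0u y0v g0 nz.
have pos x y : u < x < u' -> v < y < v' -> 0 < g x y.
  move=> xu yv; apply: (continuous_nz_gt0 (c2 x) (nz x^~ xu) y0v yv).
  by apply: (continuous_nz_gt0 (c1 y0) (fun t tu => nz t y0 tu y0v) x0u xu).
move=> x y xu; apply: (continuous_ge0_closure vv (c2 x)) => t tv.
move: xu; apply: (continuous_ge0_closure uu (c1 t)) => s su.
by rewrite ltW ?pos.
Qed.

Lemma rect_diff_third g x y h k : separately_continuous g -> 0 < h -> 0 < k ->
  exists x' y', [/\ x < x', x' < x + 2 * h, y < y', y' < y + 2 * k &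
    rect_diff g x y (x + 3 * h) (y + 3 * k) =
    9 * rect_diff g x' y' (x' + h) (y' + k)].
Proof.
move=> cg h0 k0; apply: contrapT => no.
pose D := rect_diff g x y (x + 3 * h) (y + 3 * k).
(* [G s t] vanishes exactly when the small rectangle with lower-left corner [(s, t)] has the mean
   slope of the large one. *)
pose G s t := rect_diff g s t (s + h) (t + k) - D / 9.
have cG : separately_continuous G.
  case: cg => c1 c2; split=> z t; rewrite /G /rect_diff;
    (apply: cvgB; last exact: cvg_cst); (apply: cvgD; [apply: cvgB; [apply: cvgB|]|]).
  - apply: (@continuous_comp _ _ _ (fun s => s + h) (g^~ (z + k))); last exact: c1.
    by apply: cvgD; [exact: cvg_id|exact: cvg_cst].
  - apply: (@continuous_comp _ _ _ (fun s => s + h) (g^~ z)); last exact: c1.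
    by apply: cvgD; [exact: cvg_id|exact: cvg_cst].
  - exact: c1.
  - exact: c1.
  - apply: (@continuous_comp _ _ _ (fun s => s + k) (g (z + h))); last exact: c2.
    by apply: cvgD; [exact: cvg_id|exact: cvg_cst].
  - exact: c2.
  - apply: (@continuous_comp _ _ _ (fun s => s + k) (g z)); last exact: c2.
    by apply: cvgD; [exact: cvg_id|exact: cvg_cst].
  - exact: c2.
have nz s t : x < s < x + 2 * h -> y < t < y + 2 * k -> G s t != 0.
  move=> /andP[? ?] /andP[? ?]; apply/eqP; rewrite /G => e; apply: no.
  by exists s, t; split => //; rewrite -/D; lra.
have sum0 : G x y + G (x + h) y + G (x + 2 * h) y
  + (G x (y + k) + G (x + h) (y + k) + G (x + 2 * h) (y + k))
  + (G x (y + 2 * k) + G (x + h) (y + 2 * k) + G (x + 2 * h) (y + 2 * k)) = 0.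
  rewrite /G /D /rect_diff.
  rewrite (_ : x + h + h = x + 2 * h); last ring.
  rewrite (_ : x + 2 * h + h = x + 3 * h); last ring.
  rewrite (_ : y + k + k = y + 2 * k); last ring.
  rewrite (_ : y + 2 * k + k = y + 3 * k); last ring.
  by field.
(* Of the nine grid positions only the centre [(x + h, y + k)] is interior: it carries the strict
   sign, the other eight the weak one. A general [H] serves both [G] and its opposite. *)
have contra (H : R -> R -> R) : separately_continuous H ->
    0 < H (x + h) (y + k) ->
    (forall s t, x < s < x + 2 * h -> y < t < y + 2 * k -> H s t != 0) ->
    0 < H x y + H (x + h) y + H (x + 2 * h) y
      + (H x (y + k) + H (x + h) (y + k) + H (x + 2 * h) (y + k))
      + (H x (y + 2 * k) + H (x + h) (y + 2 * k) + H (x + 2 * h) (y + 2 * k)).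
  move=> cH H0 nzH.
  have ge0 s t : x <= s <= x + 2 * h -> y <= t <= y + 2 * k -> 0 <= H s t.
    by apply: (separately_continuous_nz_ge0 cH _ _ _ _ H0 nzH); lra.
  have H1 := ge0 x y; have H2 := ge0 (x + h) y; have H3 := ge0 (x + 2 * h) y.
  have H4 := ge0 x (y + k); have H5 := ge0 (x + 2 * h) (y + k).
  have H6 := ge0 x (y + 2 * k); have H7 := ge0 (x + h) (y + 2 * k).
  have H8 := ge0 (x + 2 * h) (y + 2 * k).
  have a1 : x <= x <= x + 2 * h by lra.
  have a2 : x <= x + h <= x + 2 * h by lra.
  have a3 : x <= x + 2 * h <= x + 2 * h by lra.
  have b1 : y <= y <= y + 2 * k by lra.
  have b2 : y <= y + k <= y + 2 * k by lra.
  have b3 : y <= y + 2 * k <= y + 2 * k by lra.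
  move: (H1 a1 b1) (H2 a2 b1) (H3 a3 b1) (H4 a1 b2) (H5 a3 b2) (H6 a1 b3)
    (H7 a2 b3) (H8 a3 b3) H0; clear; lra.
have : G (x + h) (y + k) != 0 by apply: nz; lra.
rewrite neq_lt => /orP[neg|pos]; last by move: (contra G cG pos nz); rewrite sum0 ltxx.
have := contra _ (separately_continuousN cG).
rewrite oppr_gt0 => /(_ neg); suff nzN : forall s t, x < s < x + 2 * h ->
    y < t < y + 2 * k -> - G s t != 0 by move=> /(_ nzN); lra.
by move=> s t ? ?; rewrite oppr_eq0 nz.
Qed.

(* Each rectangle lies strictly inside the previous one, so the common point is
   never on an edge, where the mean slopes based at it would degenerate. *)
Lemma nested_same_slope g x y h k : separately_continuous g -> 0 < h -> 0 < k ->
  exists c1 c2 : R, exists p : nat -> R * R, forall n,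
    [/\ (p n).1 < c1 < (p n).1 + h / 3 ^+ n,
        (p n).2 < c2 < (p n).2 + k / 3 ^+ n,
        x <= (p n).1 /\ (p n).1 + h / 3 ^+ n <= x + h,
        y <= (p n).2 /\ (p n).2 + k / 3 ^+ n <= y + k &
        rect_diff g x y (x + h) (y + k) = 9 ^+ n *
        rect_diff g (p n).1 (p n).2 ((p n).1 + h / 3 ^+ n) ((p n).2 + k / 3 ^+ n)].
Proof.
move=> cg h0 k0.
have h30 n : 0 < h / 3 ^+ n by rewrite divr_gt0 ?exprn_gt0.
have k30 n : 0 < k / 3 ^+ n by rewrite divr_gt0 ?exprn_gt0.
have hS n : 3 * (h / 3 ^+ n.+1) = h / 3 ^+ n.
  by rewrite exprS; field; rewrite expf_neq0.
have kS n : 3 * (k / 3 ^+ n.+1) = k / 3 ^+ n.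
  by rewrite exprS; field; rewrite expf_neq0.
(* The old side is three times the new one, so a corner less than two new sides away keeps the new
   rectangle strictly inside the old. *)
pose shrink n (p q : R * R) := [/\ p.1 < q.1 < p.1 + 2 * (h / 3 ^+ n.+1),
   p.2 < q.2 < p.2 + 2 * (k / 3 ^+ n.+1) &
   rect_diff g p.1 p.2 (p.1 + h / 3 ^+ n) (p.2 + k / 3 ^+ n) =
   9 * rect_diff g q.1 q.2 (q.1 + h / 3 ^+ n.+1) (q.2 + k / 3 ^+ n.+1)].
have ex n p : exists q, shrink n p q.
  have [x' [y' [a1 a2 a3 a4 e]]] := rect_diff_third p.1 p.2 cg (h30 n.+1) (k30 n.+1).
  exists (x', y'); rewrite /shrink /= a1 a2 a3 a4; split => //.
  by rewrite -hS -kS.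
(* The relation [shrink] depends on the stage, so the choice function acts on pairs of a stage and a
   corner. *)
have [next nextP] := choice (fun np : nat * (R * R) => ex np.1 np.2).
pose p := fix p n := if n is m.+1 then next (m, p m) else (x, y).
have pS n : shrink n (p n) (p n.+1) by exact: (nextP (n, p n)).
have e0 : p 0 = (x, y) by [].
have nest m n : (m <= n)%N -> [/\ (p m).1 <= (p n).1, (p m).2 <= (p n).2,
    (p n).1 + h / 3 ^+ n <= (p m).1 + h / 3 ^+ m &
    (p n).2 + k / 3 ^+ n <= (p m).2 + k / 3 ^+ m].
  elim: n => [|n ih]; first by rewrite leqn0 => /eqP ->.
  rewrite leq_eqVlt => /predU1P[->//|/ih[i1 i2 i3 i4]].
  case: (pS n) => /andP[s1 s2] /andP[s3 s4] _; rewrite -hS in i3.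
  rewrite -kS in i4; have := h30 n.+1; have := k30 n.+1; split; lra.
have ub1 n : ubound (range (fun m => (p m).1)) ((p n).1 + h / 3 ^+ n).
  move=> _ [m _ <-]; have := h30 m; have := h30 n.
  by case/orP: (leq_total m n) => /nest[]; lra.
have ub2 n : ubound (range (fun m => (p m).2)) ((p n).2 + k / 3 ^+ n).
  move=> _ [m _ <-]; have := k30 m; have := k30 n.
  by case/orP: (leq_total m n) => /nest[]; lra.
pose c1 := sup (range (fun m => (p m).1)); pose c2 := sup (range (fun m => (p m).2)).
have c1ge n : (p n).1 <= c1.
  by apply: ub_le_sup; [exists ((p 0).1 + h / 3 ^+ 0); exact: ub1|exists n].
have c2ge n : (p n).2 <= c2.
  by apply: ub_le_sup; [exists ((p 0).2 + k / 3 ^+ 0); exact: ub2|exists n].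
have c1le n : c1 <= (p n).1 + h / 3 ^+ n.
  by apply: ge_sup (ub1 n); exists (p 0).1; exists 0%N.
have c2le n : c2 <= (p n).2 + k / 3 ^+ n.
  by apply: ge_sup (ub2 n); exists (p 0).2; exists 0%N.
have slope n : rect_diff g x y (x + h) (y + k) = 9 ^+ n *
    rect_diff g (p n).1 (p n).2 ((p n).1 + h / 3 ^+ n) ((p n).2 + k / 3 ^+ n).
  elim: n => [|n ->]; first by rewrite e0 /= expr0 !divr1 mul1r.
  by case: (pS n) => _ _ ->; rewrite (exprSr 9) mulrA.
exists c1, c2, p => n; case: (pS n) => /andP[s1 s2] /andP[s3 s4] _.
have [n1 n2 n3 n4] := nest 0%N n isT; rewrite e0 /= expr0 !divr1 in n1 n2 n3 n4.
(* Weak bounds at stage [n.+1] become strict at stage [n], since each rectangle is strictly inside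
   its predecessor. *)
have A := c1ge n.+1; have B := c2ge n.+1; have C := c1le n.+1; have D := c2le n.+1.
have := hS n; have := kS n; have := h30 n.+1; have := k30 n.+1 => P1 P2 P3 P4.
split; [lra|lra|split; lra|split; lra|exact: slope].
Qed.
End MeanSlopes.

(** * From one-sided limits of double increments to separate continuity *)

Section SeparateContinuity.
Context {R : realType}.
Implicit Types (g : R -> R -> R) (s t : sign) (u v x y z e d : R).

(** This is connectedness of a segment: the supremum of the points related to [u] is itself related
    to [u], and if it were below [x] the local hypothesis would reach past it. Reflexivity at [u] is
    the case [y = x] of that hypothesis. *)
Lemma interval_chain (E : R -> R -> Prop) u v :
  (forall x y, E x y -> E y x) -> (forall x y z, E x y -> E y z -> E x z) ->
  (forall x, u <= x <= v -> exists2 d, 0 < d &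
     forall y, u <= y <= v -> `|y - x| < d -> E x y) ->
  forall x, u <= x <= v -> E u x.
Proof.
move=> Esym Etrans loc x /andP[ux xv].
pose S := [set y | u <= y <= x /\ E u y].
have Su : S u.
  have [|d d0 Eu] := loc u; first lra.
  by split; [lra|apply: Eu; [lra|rewrite subrr normr0]].
have ubS : ubound S x by move=> y [/andP[]].
have us : u <= sup S by apply: ub_le_sup => //; exists x.
have sx : sup S <= x by apply: ge_sup => //; exists u.
have [|d d0 Es] := loc (sup S); first lra.
have [|r Sr rs] := @sup_adherent _ S d d0; first by split; [exists u|exists x].
have rles : r <= sup S by apply: ub_le_sup => //; exists x.
have {Sr} [ur Eur] := Sr.
have Eus : E u (sup S).
  apply: Etrans Eur _; apply: Esym; apply: Es; first lra.
  by rewrite ltr_norml; lra.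
have [sltx|] := ltP (sup S) x; last first.
  by move=> xs; rewrite (_ : x = sup S) //; apply/eqP; rewrite eq_le xs sx.
have /(ub_le_sup (ex_intro _ x ubS)) : S (Num.min x (sup S + d / 2)).
  split; first by rewrite ge_min lexx le_min ux /=; lra.
  apply: Etrans Eus _; apply: Es.
    by rewrite ge_min le_min ux xv /=; lra.
  by rewrite ltr_norml; case: (leP x (sup S + d / 2)); lra.
by rewrite ge_min; lra.
Qed.

(* A box over [u, v] has points beyond [x] on the side [s]. *)
Definition room (s : sign) x u v : Prop :=
  match s with Plus => x < v | Minus => u < x end.

(* Only continuity in the second variable; the other half of double continuity is
   this property of the transposed function. *)
Definition locally_continuous_increments g u v u' v' : Prop :=
  forall x y s t, u <= x <= v -> u' <= y <= v' -> room s x u v -> room t y u' v' ->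
  exists2 e, 0 < e & forall x1, half_interval s x e x1 ->
    rect_diff g x y x1 y1 @[y1 --> at_side t y] --> 0.

Definition on_side (s : sign) x y : Prop :=
  match s with Plus => x <= y | Minus => y <= x end.

Lemma near_at_side s x (P : R -> Prop) : (\forall y \near at_side s x, P y) ->
  exists2 d, 0 < d & forall y, on_side s x y -> y != x -> `|y - x| < d -> P y.
Proof.
case: s => /nbhs_ballP[d /= d0 dP]; exists d => // y sy yx xy; apply: dP => //.
- by rewrite /ball /= distrC.
- by rewrite lt_neqAle eq_sym yx.
- by rewrite /ball /= distrC.
- by rewrite lt_neqAle yx.
Qed.

Lemma quadrant_increments g u v u' v' x y s t :
  locally_continuous_increments g u v u' v' -> u <= x <= v -> u' <= y <= v' ->
  exists2 e, 0 < e & forall x1, u <= x1 <= v -> on_side s x x1 -> `|x1 - x| < e ->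
    forall eps : R, 0 < eps -> exists2 d, 0 < d & forall y1, u' <= y1 <= v' ->
      on_side t y y1 -> `|y1 - y| < d -> `|rect_diff g x y x1 y1| < eps.
Proof.
move=> lg xuv yuv.
(* Without room on a side, the only point of the box on that side is the base point itself, and the
   increment is zero; so all four sign pairs can be treated alike. *)
have [rs|nrs] := pselect (room s x u v); last first.
  exists 1 => // x1 x1uv sx1 _ eps eps0; exists 1 => // y1 _ _ _.
  have -> : x1 = x.
    by apply/eqP; rewrite eq_le; case: s nrs sx1 => /= /negP; rewrite -leNgt; lra.
  by rewrite (_ : rect_diff _ _ _ _ _ = 0) ?normr0 // /rect_diff; ring.
have [rt|nrt] := pselect (room t y u' v'); last first.
  exists 1 => // x1 x1uv sx1 _ eps eps0; exists 1 => // y1 y1uv ty1 _.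
  have -> : y1 = y.
    by apply/eqP; rewrite eq_le; case: t nrt ty1 => /= /negP; rewrite -leNgt; lra.
  by rewrite (_ : rect_diff _ _ _ _ _ = 0) ?normr0 // /rect_diff; ring.
have [e e0 lim] := lg _ _ _ _ xuv yuv rs rt.
exists e => // x1 x1uv sx1 x1e eps eps0.
have /lim lim1 : half_interval s x e x1.
  by case: s sx1 {rs lim} => /= sx1; move: x1e; rewrite ltr_norml; lra.
have near0 : \forall y1 \near at_side t y, `|rect_diff g x y x1 y1| < eps.
  have FF : Filter (at_side t y) by case: (t); apply: within_filter.
  exact: (proj1 (cvgr0Pnorm_lt _) lim1).
have [d d0 dP] := near_at_side near0; exists d => // y1 _ ty1 y1d.
(* The one-sided limit omits [y] itself, where the increment vanishes. *)
have [->|ny] := eqVneq y1 y; last exact: dP.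
by rewrite (_ : rect_diff _ _ _ _ _ = 0) ?normr0 // /rect_diff; ring.
Qed.

(** Smallness of the increments based at [(x, y)] is known only for end points near [x]. Since
    [rect_diff] is additive in the first variable, it defines an equivalence between abscissae,
    which [interval_chain] propagates from the edge [u]. *)
Lemma increments_continuous g u v u' v' x y :
  locally_continuous_increments g u v u' v' -> u <= x <= v -> u' <= y <= v' ->
  forall eps : R, 0 < eps -> exists2 d, 0 < d & forall y1, u' <= y1 <= v' ->
    `|y1 - y| < d -> `|rect_diff g u y x y1| < eps.
Proof.
move=> lg + yuv; move: x.
pose E x z := forall eps : R, 0 < eps -> exists2 d, 0 < d & forall y1,
  u' <= y1 <= v' -> `|y1 - y| < d -> `|rect_diff g x y z y1| < eps.
apply: (@interval_chain E).
- move=> x z Exz eps /Exz[d d0 dP]; exists d => // y1 y1uv /(dP y1 y1uv).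
  by rewrite -normrN; congr (`|_| < _); rewrite /rect_diff; ring.
- move=> x z w Exz Ezw eps eps0; have e20 : 0 < eps / 2 by lra.
  have [d d0 dP] := Exz _ e20; have [d' d'0 d'P] := Ezw _ e20.
  exists (Num.min d d') => [|y1 y1uv]; first by rewrite lt_min d0.
  rewrite lt_min => /andP[/(dP y1 y1uv) A /(d'P y1 y1uv) B].
  rewrite (_ : rect_diff g x y w y1 = rect_diff g x y z y1 + rect_diff g z y w y1).
    by apply: le_lt_trans (ler_normD _ _) _; lra.
  by rewrite /rect_diff; ring.
move=> x xuv.
(* The quadrants are glued in two stages: above and below [y] here, then left and right of [x]. *)
have half s : exists2 e, 0 < e & forall x1, u <= x1 <= v -> on_side s x x1 ->
    `|x1 - x| < e -> E x x1.
  have [e e0 eP] := @quadrant_increments g u v u' v' x y s Plus lg xuv yuv.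
  have [e' e'0 e'P] := @quadrant_increments g u v u' v' x y s Minus lg xuv yuv.
  exists (Num.min e e') => [|x1 x1uv sx1]; first by rewrite lt_min e0.
  rewrite lt_min => /andP[x1e x1e'] eps eps0.
  have [d d0 dP] := eP x1 x1uv sx1 x1e eps eps0.
  have [d' d'0 d'P] := e'P x1 x1uv sx1 x1e' eps eps0.
  exists (Num.min d d') => [|y1 y1uv]; first by rewrite lt_min d0.
  rewrite lt_min => /andP[y1d y1d'].
  by have [yy1|/ltW y1y] := leP y y1; [exact: dP|exact: d'P].
have [e e0 eP] := half Plus; have [e' e'0 e'P] := half Minus.
exists (Num.min e e') => [|x1 x1uv]; first by rewrite lt_min e0.
rewrite lt_min => /andP[x1e x1e'].
by have [xx1|/ltW x1x] := leP x x1; [exact: eP|exact: e'P].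
Qed.

(* Clamping extends a function given on a box to the whole plane, so that
   continuity need not be relativised to the box. *)
Definition clamp u v x : R := Num.max u (Num.min x v).

Lemma clamp_in u v x : u <= v -> u <= clamp u v x <= v.
Proof. by move=> uv; rewrite le_max lexx ge_max uv ge_min lexx orbT. Qed.

Lemma clamp_id u v x : u <= x <= v -> clamp u v x = x.
Proof.
by move=> /andP[ux xv]; rewrite /clamp; rewrite (min_idPl xv) (max_idPr ux).
Qed.

Lemma clamp_lipschitz u v x y : u <= v -> `|clamp u v x - clamp u v y| <= `|x - y|.
Proof.
move=> uv; wlog xy : x y / x <= y.
  by move=> W; case/orP: (le_total x y) => /W //; rewrite distrC (distrC y).
rewrite (distrC x) (ger0_norm (_ : 0 <= y - x)); last lra.
rewrite /clamp ler_norml.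
have [?|?] := leP x v; have [?|?] := leP y v; have [?|?] := leP u v;
  have [?|?] := leP u x; have [?|?] := leP u y; lra.
Qed.

Lemma clamped_increment_continuous g u v u' v' x :
  u <= v -> u' <= v' -> locally_continuous_increments g u v u' v' ->
  continuous (fun y => rect_diff g u u' (clamp u v x) (clamp u' v' y)).
Proof.
move=> uv uv' lg y; apply/cvgrPdist_lt => eps eps0.
have [d d0 dP] :=
  increments_continuous lg (clamp_in x uv) (clamp_in y uv') eps0.
apply/nbhs_ballP; exists d => // y1 yy1 /=; rewrite distrC.
(* By additivity in the second variable, moving the upper edge leaves a rectangle based at [u] with
   only the moved strip. *)
rewrite (_ : _ - _ = rect_diff g u (clamp u' v' y) (clamp u v x) (clamp u' v' y1)).
  apply: dP; first exact: clamp_in.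
  by apply: le_lt_trans (clamp_lipschitz _ _ uv') _; rewrite distrC.
by rewrite /rect_diff; ring.
Qed.
End SeparateContinuity.

(** * Double functions on a box and identification of the derivative *)

Section MeanValue.
Context {R : realType}.
Implicit Types (f : double_function R) (a b c p : R * R) (s t : sign).

(** Interior and boundary points get a uniform form: a two-sided limit restricts to each side, and
    at the boundary [room] in both directions supplies a quadrant inside the box. *)
Lemma double_continuous_signed_limits f a b p s t :
  double_continuous_on_box f a b -> closed_box a b p ->
  room s p.1 a.1 b.1 -> room t p.2 a.2 b.2 ->
  exists2 e : R, 0 < e &
    (forall x1, half_interval s p.1 e x1 ->
       double_difference f p (x1, x2) @[x2 --> at_side t p.2] --> 0) /\
    (forall x2, half_interval t p.2 e x2 ->
       double_difference f p (x1, x2) @[x1 --> at_side s p.1] --> 0).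
Proof.
move=> [fint fbnd] pab rs rt.
have [pint|pbnd] := pselect ((closed_box a b)° p).
  have [I1 [I2 [[[opI1 _] [opI2 _]] /=[Ip1 Ip2] _ lim1 lim2]]] := fint p pint.
  have /nbhs_ballP[e1 /= e10 e1I] := open_nbhs_nbhs (conj opI1 Ip1).
  have /nbhs_ballP[e2 /= e20 e2I] := open_nbhs_nbhs (conj opI2 Ip2).
  have half r x e y : half_interval r x e y -> `|x - y| < e.
    by rewrite ltr_norml; case: r => /=; lra.
  exists (Num.min e1 e2); first by rewrite lt_min e10.
  split=> x /half; rewrite lt_min => /andP[xe1 xe2].
    have := lim1 x (e1I x xe1).
    by case: t {rt}; [exact: cvg_dnbhs_at_right|exact: cvg_dnbhs_at_left].
  have := lim2 x (e2I x xe2).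
  by case: s {rs}; [exact: cvg_dnbhs_at_right|exact: cvg_dnbhs_at_left].
have [|[d1 d2] /=[[d10 d20] _ lim1 lim2]] := fbnd p (conj pab pbnd) s t.
  (* The quadrant extends up to the edges of the box in the directions [s] and [t]. *)
  exists (if s is Plus then b.1 - p.1 else p.1 - a.1,
          if t is Plus then b.2 - p.2 else p.2 - a.2).
  case: pab => [[ap1 ap2] [pb1 pb2]] /=; split.
    by case: s rs => /= rs; case: t rt => /= rt; lra.
  move=> [x1 x2] [x1s x2t]; rewrite /= in x1s x2t; rewrite /closed_box /pt_le /=.
  by case: s rs x1s => /= rs x1s; case: t rt x2t => /= rt x2t; lra.
have half r x (e e' : R) y : e <= e' -> half_interval r x e y -> half_interval r x e' y.
  by case: r => /=; lra.
exists (Num.min d1 d2); first by rewrite lt_min d10.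
by split=> x xs; [apply: lim1|apply: lim2]; apply: half xs; rewrite ge_min lexx ?orbT.
Qed.

Lemma double_continuous_increments f a b : double_continuous_on_box f a b ->
  locally_continuous_increments (fun x y => f (x, y)) a.1 b.1 a.2 b.2 /\
  locally_continuous_increments (fun y x => f (x, y)) a.2 b.2 a.1 b.1.
Proof.
move=> fc; split=> x y s t xab yab rs rt.
  have pab : closed_box a b (x, y) by rewrite /closed_box /pt_le /=; lra.
  have [e e0 [lim1 _]] := double_continuous_signed_limits fc pab rs rt.
  by exists e.
have pab : closed_box a b (y, x) by rewrite /closed_box /pt_le /=; lra.
have [e e0 [_ lim2]] := double_continuous_signed_limits fc pab rt rs.
exists e => // x1 x1s; suff -> : rect_diff (fun y x => f (x, y)) x y x1 =
    fun y1 => double_difference f (y, x) (y1, x1) by exact: lim2.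
by apply/funext => y1; rewrite /rect_diff /double_difference /=; ring.
Qed.

(** Adding functions of one variable to [f] leaves its double differences unchanged, so [f] itself
    may be discontinuous. The clamped increment from [a] removes such terms and keeps every double
    difference on the box. *)
Lemma double_continuous_extension f a b : pt_lt a b ->
  double_continuous_on_box f a b ->
  exists2 g : R -> R -> R, separately_continuous g &
    forall u v x y, closed_box a b (u, v) -> closed_box a b (x, y) ->
      rect_diff g u v x y = double_difference f (u, v) (x, y).
Proof.
move=> [/ltW ab1 /ltW ab2] /double_continuous_increments[inc1 inc2].
exists (fun x y => rect_diff (fun x y => f (x, y)) a.1 a.2
                     (clamp a.1 b.1 x) (clamp a.2 b.2 y)).
  split=> z; last exact: clamped_increment_continuous.
  (* Continuity in the first variable is the same statement for the transposed function. *)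
  set gz := (gz in continuous gz); rewrite (_ : gz = fun x =>
    rect_diff (fun y x => f (x, y)) a.2 a.1 (clamp a.2 b.2 z) (clamp a.1 b.1 x)).
    exact: clamped_increment_continuous.
  by apply/funext => x; rewrite /gz /rect_diff; ring.
move=> u v x y; rewrite /closed_box /pt_le /= => uv xy.
rewrite /rect_diff !clamp_id; try lra.
by rewrite /double_difference /=; ring.
Qed.

Lemma shrinking_lt (h d : R) : 0 < d ->
  \forall n \near \oo, h / 3 ^+ n < d.
Proof.
move=> d0; have z1 : `|3^-1 : R| < 1 by rewrite gtr0_norm ?invr_gt0 //; lra.
have /cvgr0Pnorm_lt/(_ d d0) := cvg_geometric h z1.
by apply: filterS => n /= /(le_lt_trans (ler_norm _)); rewrite exprVn.
Qed.

(** Clearing the denominator gives an error bound proportional to area, which can be added over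
    adjacent rectangles. *)
Lemma mean_slope_increment f c x (l eps : R) :
  x.1 != c.1 -> x.2 != c.2 -> `|double_mean_slope f c x - l| < eps ->
  `|double_difference f c x - l * ((x.1 - c.1) * (x.2 - c.2))| <
  eps * `|(x.1 - c.1) * (x.2 - c.2)|.
Proof.
move=> x1 x2; have A0 : (x.1 - c.1) * (x.2 - c.2) != 0.
  by rewrite mulf_neq0 ?subr_eq0.
rewrite -(ltr_pM2r (_ : 0 < `|(x.1 - c.1) * (x.2 - c.2)|)) ?normr_gt0 //.
by rewrite -normrM mulrBl divfK.
Qed.

(** The point [c] cuts a small rectangle into four, each with a corner at [c]. With tolerance
    [|l - m|] their errors add up to strictly less than [|l - m|] times the total area, yet the
    total error is exactly that product. *)
Lemma double_derivative_nested f c (l m : R) (r : nat -> R * R) (h k : R) :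
  is_double_derivative f c l ->
  (forall n, (r n).1 < c.1 < (r n).1 + h / 3 ^+ n) ->
  (forall n, (r n).2 < c.2 < (r n).2 + k / 3 ^+ n) ->
  (forall n, double_difference f (r n) ((r n).1 + h / 3 ^+ n, (r n).2 + k / 3 ^+ n)
     = m * ((h / 3 ^+ n) * (k / 3 ^+ n))) ->
  l = m.
Proof.
move=> [_ deriv] rc1 rc2 slope; apply/eqP; rewrite -subr_eq0 -normr_eq0.
apply: contraT => lm0; have eps0 : 0 < `|l - m| by rewrite lt_neqAle eq_sym lm0 /=.
have [[d1 d2] [/=[d10 d20] dP]] := deriv _ eps0.
have [n [hd kd]] : exists n, h / 3 ^+ n < d1 /\ k / 3 ^+ n < d2.
  by near \oo => n; exists n; split; near: n; exact: shrinking_lt.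
move: (rc1 n) (rc2 n) (slope n) hd kd.
set hn := h / _; set kn := k / _; set x := (r n).1; set y := (r n).2.
move=> xc yc sl hd kd.
have corner u v : (u == x) || (u == x + hn) -> (v == y) || (v == y + kn) ->
    `|double_difference f c (u, v) - l * ((u - c.1) * (v - c.2))| <
    `|l - m| * `|(u - c.1) * (v - c.2)|.
  move=> ux vy.
  have u0 : u - c.1 != 0 by case/orP: ux => /eqP ->; lra.
  have v0 : v - c.2 != 0 by case/orP: vy => /eqP ->; lra.
  have ud : `|u - c.1| < d1 by rewrite ltr_norml; case/orP: ux => /eqP ->; lra.
  have vd : `|v - c.2| < d2 by rewrite ltr_norml; case/orP: vy => /eqP ->; lra.
  have [|| _ b] := dP (u, v); rewrite /= ?normr_gt0 ?u0 ?v0 //.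
  by apply: (mean_slope_increment _ _ b); rewrite /= -subr_eq0.
have := corner x y; have := corner x (y + kn); have := corner (x + hn) y.
have := corner (x + hn) (y + kn); rewrite !eqxx !orbT !normrM.
rewrite !(gtr0_norm (_ : 0 < x + hn - c.1)); try lra.
rewrite !(gtr0_norm (_ : 0 < y + kn - c.2)); try lra.
rewrite !(ltr0_norm (_ : x - c.1 < 0)); try lra.
rewrite !(ltr0_norm (_ : y - c.2 < 0)); try lra.
move=> /(_ isT isT) C1 /(_ isT isT) C2 /(_ isT isT) C3 /(_ isT isT) C4.
have hk0 : 0 < hn * kn by rewrite mulr_gt0; lra.
suff : `|(m - l) * (hn * kn)| < `|l - m| * (hn * kn).
  by rewrite normrM (gtr0_norm hk0) distrC ltxx.
(* The double difference over the rectangle is the alternating sum of those from [c] to its corners,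
   and the signed areas combine in the same way. *)
rewrite mulrBl -sl (_ : _ - _ =
  (double_difference f c (x + hn, y + kn)
     - l * ((x + hn - c.1) * (y + kn - c.2)))
  - (double_difference f c (x + hn, y) - l * ((x + hn - c.1) * (y - c.2)))
  - (double_difference f c (x, y + kn) - l * ((x - c.1) * (y + kn - c.2)))
  + (double_difference f c (x, y) - l * ((x - c.1) * (y - c.2)))); last first.
  by rewrite /double_difference /= -/x -/y; ring.
rewrite (_ : `|l - m| * (hn * kn) =
  `|l - m| * ((x + hn - c.1) * (y + kn - c.2))
  + `|l - m| * ((x + hn - c.1) * - (y - c.2))
  + `|l - m| * (- (x - c.1) * (y + kn - c.2))
  + `|l - m| * (- (x - c.1) * - (y - c.2))); last by ring.
do 3 (apply: (le_lt_trans (ler_normD _ _)); rewrite ?normrN; apply: ltrD => //).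
Unshelve. all: by end_near.
Qed.
End MeanValue.

Theorem proposition18 (R : realType) (a b : R * R) (f : double_function R) :
  pt_lt a b ->
  dom f = closed_box a b ->
  double_continuous_on_box f a b ->
  (forall p : R * R, open_box a b p -> double_differentiable_at f p) ->
  exists c : R * R,
    open_box a b c /\ is_double_derivative f c (double_mean_slope f a b).
Proof.
move=> ab fdom fcont fdiff.
have [g cg gf] := double_continuous_extension ab fcont.
have [ab1 ab2] := ab.
have h0 : 0 < b.1 - a.1 by rewrite subr_gt0.
have k0 : 0 < b.2 - a.2 by rewrite subr_gt0.
have [c1 [c2 [r rP]]] := nested_same_slope a.1 a.2 cg h0 k0.
have cab : open_box a b (c1, c2).
  by have [] := rP 0%N; rewrite /open_box /pt_lt /=; lra.
exists (c1, c2); split => //; have [l fl] := fdiff _ cab.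
suff <- : l = double_mean_slope f a b by [].
apply: (double_derivative_nested (r := r) (h := b.1 - a.1) (k := b.2 - a.2) fl) => n;
  have [r1 r2 r3 r4] := rP n => //.
rewrite (_ : a.1 + (b.1 - a.1) = b.1) in r3 *; last by ring.
rewrite (_ : a.2 + (b.2 - a.2) = b.2) in r4 *; last by ring.
have lo : closed_box a b (a.1, a.2).
  by rewrite /closed_box /pt_le /= !lexx (ltW ab1) (ltW ab2).
have hi : closed_box a b (b.1, b.2).
  by rewrite /closed_box /pt_le /= !lexx (ltW ab1) (ltW ab2).
have rlo : closed_box a b ((r n).1, (r n).2).
  by clear lo hi; move: r1 r2 r3 r4; rewrite /closed_box /pt_le /=; lra.
have rhi : closed_box a b ((r n).1 + (b.1 - a.1) / 3 ^+ n,
                           (r n).2 + (b.2 - a.2) / 3 ^+ n).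
  by clear lo hi rlo; move: r1 r2 r3 r4; rewrite /closed_box /pt_le /=; lra.
rewrite (gf _ _ _ _ lo hi) (gf _ _ _ _ rlo rhi) -!surjective_pairing.
rewrite /double_mean_slope => ->.
have t0 : 3 ^+ n != 0 :> R by rewrite expf_neq0.
(* The factor [9 ^+ n] is the ratio of the areas, so equal slopes are what [rP] expresses. *)
rewrite (_ : 9 ^+ n = 3 ^+ n * 3 ^+ n); last by rewrite -exprMn; congr (_ ^+ n); ring.
by field; rewrite t0 !gt_eqF.
Qed.
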